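(* Let $n\ge2$, $r\in[n]$ and $k\in[n-1]$. The map $T\mapsto(\phi_{glo}(T),\psi(T))$ is a bijection from $\mathcal{T}^{(r)}_{n,k}$ to $\Pi^{(r)}_{n,k}\times\mathcal{S}^{(r)}_{n,k}$. Moreover, the global indegree sequence of $T$ equals the type of $\phi_{glo}(T)$.
   Context: Consider a labeled tree on $[n]=\{1,\dots,n\}$ rooted at $r$, with edges oriented towards the root. - A vertex is a leaf if it has no children. - The child-group $G_v$ of a vertex $v$ is the set of its children. - A leaf-group is a nonempty child-group all of whose members are leaves. - Leaf-groups are totally ordered by comparing their maximal elements. $\mathcal{T}^{(r)}_{n,k}$ is the set of labeled trees on $[n]$ rooted at $r$ having exactly $k$ nonempty child-groups. $\phi_{glo}(T)$ is the set of nonempty child-groups of $T$; it is a set partition of $[n]\setminus\{r\}$. $\psi(T)$ is defined as follows. Put $T_0=T$. For $i=1,\dots,k$, let $L_i$ be the largest leaf-group of $T_{i-1}$, let $p_i$ be the parent of the vertices of $L_i$ in $T_{i-1}$, and let $T_i$ be obtained from $T_{i-1}$ by deleting the vertices of $L_i$ and their edges. Then $\psi(T)=(p_1,\dots,p_k)$. $\Pi^{(r)}_{n,k}$ is the set of set partitions of $[n]\setminus\{r\}$ into $k$ blocks. $\mathcal{S}^{(r)}_{n,k}$ is the set of sequences $(p_1,\dots,p_k)$ of $k$ distinct elements of $[n]$ with $p_k=r$. The global indegree sequence of $T$ is the integer partition $1^{e_1}2^{e_2}\cdots$, where $e_i$ is the number of vertices with exactly $i$ children. The type of a set partition is the integer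 partition $1^{e_1}2^{e_2}\cdots$, where $e_i$ is the number of blocks of size $i$. *)

(* Defs.v *)
From mathcomp Require Import all_boot.

Set Implicit Arguments.
Unset Strict Implicit.
Unset Printing Implicit Defensive.

(* The label i in [n] is the ordinal of value i - 1; only the order of the
   labels matters.  A graph on [n] is given by its set of edges, an edge being
   the set of its two endpoints.  The bounded sequences [n.-bseq 'I_n] lose
   nothing below: a duplicate-free sequence over ['I_n] has size at most n. *)

Definition adj (n : nat) (E : {set {set 'I_n}}) : rel 'I_n :=
  [rel x y | [set x; y] \in E].

Definition is_tree (n : nat) (E : {set {set 'I_n}}) : bool :=
  [&& [forall e in E, #|e| == 2],
      [forall x, forall y, connect (adj E) x y] &
      [forall c : n.-bseq 'I_n, (2 < size c) ==> ~~ ucycleb (adj E) c]].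

(* v is a child of w: w is the vertex following v on the path from v to the
   root r, that is, the edge vw oriented towards the root is v -> w. *)
Definition is_child (n : nat) (r : 'I_n) (E : {set {set 'I_n}})
    (w v : 'I_n) : bool :=
  [exists p : n.-bseq 'I_n,
    [&& path (adj E) v (w :: p), uniq [:: v, w & p] & last w p == r]].

Definition child_group (n : nat) (r : 'I_n) (E : {set {set 'I_n}})
    (w : 'I_n) : {set 'I_n} :=
  [set v | is_child r E w v].

Definition is_leaf (n : nat) (r : 'I_n) (E : {set {set 'I_n}})
    (v : 'I_n) : bool :=
  child_group r E v == set0.

Definition phi_glo (n : nat) (r : 'I_n) (E : {set {set 'I_n}}) :
    {set {set 'I_n}} :=
  [set child_group r E w | w : 'I_n] :\ set0.

Definition trees (n : nat) (r : 'I_n) (k : nat) : {set {set {set 'I_n}}} :=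
  [set E | is_tree E & #|phi_glo r E| == k].

Definition leaf_groups (n : nat) (r : 'I_n) (E : {set {set 'I_n}}) :
    {set {set 'I_n}} :=
  [set G in phi_glo r E | [forall v in G, is_leaf r E v]].

Definition max_label (n : nat) (G : {set 'I_n}) : nat := \max_(v in G) v.

(* The default set0 is only reached when there is no leaf-group, that is, when
   the tree is reduced to its root. *)
Definition largest_leaf_group (n : nat) (r : 'I_n) (E : {set {set 'I_n}}) :
    {set 'I_n} :=
  odflt set0 [pick G in leaf_groups r E |
    [forall H in leaf_groups r E, max_label H <= max_label G]].

Definition parent_of_group (n : nat) (r : 'I_n) (E : {set {set 'I_n}})
    (G : {set 'I_n}) : 'I_n :=
  odflt r [pick p | child_group r E p == G].

(* Passes from T_{i-1} to T_i.  The trees T_i live on subsets of [n]; as only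
   their edges are recorded, the deleted vertices stay as isolated vertices,
   which belong to no child-group and have no children. *)
Definition delete_largest (n : nat) (r : 'I_n) (E : {set {set 'I_n}}) :
    {set {set 'I_n}} :=
  [set e in E | [disjoint e & largest_leaf_group r E]].

Definition psi (n : nat) (r : 'I_n) (k : nat) (E : {set {set 'I_n}}) :
    k.-tuple 'I_n :=
  [tuple (let Ti := iter i (delete_largest r) E in
          parent_of_group r Ti (largest_leaf_group r Ti)) | i < k].

Definition partitions (n : nat) (r : 'I_n) (k : nat) :
    {set {set {set 'I_n}}} :=
  [set P | partition P [set~ r] & #|P| == k].

(* For k > 0 the default value of [last] is irrelevant. *)
Definition sequences (n : nat) (r : 'I_n) (k : nat) : {set k.-tuple 'I_n} :=
  [set p : k.-tuple 'I_n | uniq p & last r p == r].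

(* The integer partition 1^{e 1} 2^{e 2} ... n^{e n}, as the nondecreasing
   list of its parts. *)
Definition int_partition (n : nat) (e : nat -> nat) : seq nat :=
  flatten [seq nseq (e i) i | i <- iota 1 n].

Definition global_indegree_sequence (n : nat) (r : 'I_n)
    (E : {set {set 'I_n}}) : seq nat :=
  int_partition n (fun i => #|[set v | #|child_group r E v| == i]|).

Definition partition_type (n : nat) (P : {set {set 'I_n}}) : seq nat :=
  int_partition n (fun i => #|[set B in P | #|B| == i]|).

(* Main.v *)
(** A tree rooted at r is encoded by its parent function g, whose nonempty
fibres are the child-groups. The argument is that of Prüfer codes: psi lists
every parent exactly once and ends with r, so at each step the leaf-groups are
the remaining blocks that avoid all remaining entries of the sequence. Hence
the largest leaf-group, and its parent (the current entry), can be read off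
from the pair (phi_glo, psi). Conversely, given a partition and a sequence, at
most k - 1 of the k blocks contain an entry, since r lies in no block; attaching
the largest avoiding block to the first entry rebuilds the tree. *)

Require Import Defs.
From mathcomp Require Import all_boot.

Set Implicit Arguments.
Unset Strict Implicit.
Unset Printing Implicit Defensive.

(** Peeling off the first iterate lets the index-based definition of [psi] be read as a recursion on
    the tree. *)
Lemma mkseq_iterS (T U : Type) (D : T -> T) (F : T -> U) k x :
  mkseq (fun i => F (iter i D x)) k.+1 =
  F x :: mkseq (fun i => F (iter i D (D x))) k.
Proof.
rewrite /mkseq /= (iotaDl 1 0) -map_comp; congr (_ :: _).
by apply: eq_map => i; rewrite /= -iterSr.
Qed.

Lemma size_uniq_ord n (s : seq 'I_n) : uniq s -> size s <= n.
Proof. by move=> /card_uniqP <-; rewrite -[X in _ <= X]card_ord max_card. Qed.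

(** * Largest blocks avoiding a set of labels *)

Section LargestBlock.
Variable n : nat.
Implicit Types (P : {set {set 'I_n}}) (A L : {set 'I_n}).

(** With the parents of a tree as [A] this describes its largest leaf-group; with the entries of a
    sequence as [A], the block to be attached first when decoding. *)
Definition largest_avoiding P A L : Prop :=
  [/\ L \in P, [disjoint L & A] &
      forall H, H \in P -> [disjoint H & A] -> max_label H <= max_label L].

Lemma max_label_mem L : L != set0 -> exists2 v, v \in L & max_label L = v.
Proof.
case/set0Pn=> x xL; have := @eq_bigmax_cond _ (mem L) (@nat_of_ord n).
by case=> [|v vL e]; [apply/card_gt0P; exists x | exists v].
Qed.

(** Two candidates have the same maximum; being nonempty, both contain that label, and distinct
    blocks are disjoint. *)
Lemma largest_avoiding_uniq P A L L' :
  trivIset P -> set0 \notin P ->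
  largest_avoiding P A L -> largest_avoiding P A L' -> L = L'.
Proof.
move=> /trivIsetP tP P0 [LP LA Lm] [L'P L'A L'm].
have n0 H : H \in P -> H != set0 by apply: contraTneq => ->.
have [v vL ev] := max_label_mem (n0 _ LP).
have [w wL ew] := max_label_mem (n0 _ L'P).
have evw : v = w.
  by apply/val_inj/eqP; rewrite /= -ev -ew eqn_leq Lm // L'm.
apply/eqP; apply: contraT => neq.
by have := disjointFr (tP _ _ LP L'P neq) vL; rewrite evw wL.
Qed.

Lemma largest_avoiding_ex P A G :
  G \in P -> [disjoint G & A] -> exists L, largest_avoiding P A L.
Proof.
move=> GP GA.
have G0 : (G \in P) && [disjoint G & A] by rewrite GP.
pose Q H := (H \in P) && [disjoint H & A].
case: (@arg_maxnP _ G Q (@max_label n) G0) => L /andP[LP LA] Lm.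
by exists L; split=> // H HP HA; apply: Lm; rewrite /Q HP.
Qed.

End LargestBlock.

(** * Parent functions and their edge sets *)

Section ParentFunctions.
Variables (n : nat) (r : 'I_n).
Implicit Types (g : 'I_n -> option 'I_n) (v w : 'I_n) (L : {set 'I_n}).

Definition edges g : {set {set 'I_n}} :=
  [set e : {set 'I_n} |
    [exists v, exists w, (g v == Some w) && (e == [set v; w])]].

Definition children g w : {set 'I_n} := [set v | g v == Some w].
Definition parents g : {set 'I_n} := [set w | children g w != set0].
Definition blocks g : {set {set 'I_n}} := [set children g w | w in parents g].

(** Deleted vertices are sent to [None] just like the root, so that the notion survives pruning. The
    second clause lets a chain of parents stop only at [r]; the rank [d] forbids cycles. *)
Definition rooted g : Prop :=
  [/\ g r = None,
      forall v w, g v = Some w -> w != r -> g w &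
      exists d : 'I_n -> nat, forall v w, g v = Some w -> d w < d v].

Lemma edgesP g e :
  reflect (exists v w, g v = Some w /\ e = [set v; w]) (e \in edges g).
Proof.
rewrite inE; apply: (iffP existsP) => [[v /existsP[w /andP[/eqP gv /eqP ->]]]|].
  by exists v, w.
by case=> v [w [gv ->]]; exists v; apply/existsP; exists w; rewrite gv !eqxx.
Qed.

Lemma set2_inj (x y v w : 'I_n) :
  [set x; y] = [set v; w] -> x = v /\ y = w \/ x = w /\ y = v.
Proof.
move=> e; have := set21 v w; have := set22 v w; rewrite -e.
have := set21 x y; have := set22 x y; rewrite {1 2}e.
by do 4![case/set2P=> ?]; subst; auto.
Qed.

Lemma adj_edges g x y : adj (edges g) x y = (g x == Some y) || (g y == Some x).
Proof.
apply/edgesP/orP => [[v [w [gv /set2_inj[] [-> ->]]]]|[] /eqP gx].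
- by left; apply/eqP.
- by right; apply/eqP.
- by exists x, y.
- by exists y, x; rewrite setUC.
Qed.

Lemma eq_edges g h : g =1 h -> edges g = edges h.
Proof.
by move=> e; apply/setP=> x; apply/edgesP/edgesP => -[v [w [gv ->]]];
  exists v, w; rewrite -?e // e.
Qed.

(* A simple path to the root never goes down: after a step down, it could only
   go up by turning back. *)
Lemma path_to_root_up g v w p : g r = None ->
  path (adj (edges g)) v (w :: p) -> uniq [:: v, w & p] -> last w p = r ->
  g v = Some w.
Proof.
move=> gr; elim: p v w => [|z p IH] v w.
  by rewrite /= adj_edges => /andP[/orP[]/eqP // gw _] _ wr;
    move: gw; rewrite wr gr.
move=> pth; move: (pth); rewrite [path _ _ _]/= adj_edges.
case/andP=> /orP[/eqP //|/eqP gw] pth' /andP[vn unq] lst.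
have := IH w z pth' unq lst; rewrite gw => -[e].
by move: vn; rewrite e !inE eqxx orbT.
Qed.

(** Passing to the parent lowers the rank, so the climb terminates, and it can get stuck only at
    [r]. The induction is on a strict bound of the rank. *)
Lemma up_path_to_root g v : rooted g -> v = r \/ g v ->
  exists2 p, path (fun x y => g x == Some y) v p & last v p = r.
Proof.
case=> gr up [d dg]; have [m] := ubnP (d v); elim: m v => // m IH v dv.
case=> [->|]; first by exists [::].
case gv: (g v) => [w|] // _.
have [||p pth lst] := IH w.
- by apply: leq_trans (dg _ _ gv) _; rewrite -ltnS.
- by have [->|/(up _ _ gv)] := eqVneq w r; [left | right].
by exists (w :: p) => //=; rewrite gv eqxx.
Qed.

Lemma up_path_uniq g v p : rooted g ->
  path (fun x y => g x == Some y) v p -> uniq (v :: p).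
Proof.
case=> _ _ [d dg] pth.
apply: (@sorted_uniq _ (fun x y => d y < d x)) => //.
- by move=> y x z yx zy; apply: ltn_trans yx.
- by move=> x; rewrite ltnn.
- by apply: sub_path pth => x y /eqP; apply: dg.
Qed.

Lemma is_child_edges g w v : rooted g ->
  is_child r (edges g) w v = (g v == Some w).
Proof.
move=> rg; have [gr up _] := rg.
apply/existsP/eqP => [[p /and3P[pth unq /eqP lst]]|gv].
  exact: path_to_root_up pth unq lst.
have [|p pth lst] := @up_path_to_root g w rg.
  by have [->|/(up _ _ gv)] := eqVneq w r; [left | right].
have pthv : path (fun x y => g x == Some y) v (w :: p) by rewrite /= gv eqxx.
have unq := up_path_uniq rg pthv.
(* The witness must fit in a sequence of length at most [n], which follows from the absence of
   repetitions. *)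
have sp : size p <= n by have /ltnW/ltnW := size_uniq_ord unq.
exists (Bseq sp); apply/and3P; split=> //; last exact/eqP.
apply: sub_path pthv => x y gx.
by rewrite adj_edges gx.
Qed.

(** * Child-groups and leaf-groups as fibres *)

Lemma child_group_edges g w : rooted g ->
  child_group r (edges g) w = children g w.
Proof. by move=> rg; apply/setP=> v; rewrite !inE is_child_edges. Qed.

Lemma phi_glo_edges g : rooted g -> phi_glo r (edges g) = blocks g.
Proof.
move=> rg; apply/setP=> G; rewrite !inE; apply/andP/imsetP.
  case=> G0 /imsetP[w _ e]; exists w => //.
    by rewrite inE -child_group_edges // -e.
  by rewrite -child_group_edges.
case=> w; rewrite inE => w0 ->; split=> //.
by apply/imsetP; exists w => //; rewrite child_group_edges.
Qed.

Lemma children_inj g w w' : w \in parents g -> children g w = children g w' ->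
  w = w'.
Proof.
rewrite inE => /set0Pn[v vw] e; move: (vw); rewrite e !inE.
by move: vw; rewrite inE => /eqP -> /eqP[].
Qed.

Lemma children_blocks g w v : g v = Some w -> children g w \in blocks g.
Proof.
move=> gv; apply: imset_f; rewrite inE.
by apply/set0Pn; exists v; rewrite inE gv.
Qed.

Lemma parentsP g w : reflect (exists v, g v = Some w) (w \in parents g).
Proof.
rewrite inE; apply: (iffP (set0Pn _)) => -[v e]; exists v; move: e.
  by rewrite inE => /eqP.
by rewrite inE => ->.
Qed.

Lemma trivIset_blocks g : trivIset (blocks g).
Proof.
apply/trivIsetP=> _ _ /imsetP[w _ ->] /imsetP[w' _ ->] neq.
rewrite disjoints_subset; apply/subsetP=> v; rewrite !inE => /eqP ->.
by apply: contra neq => /eqP[->].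
Qed.

Lemma set0_blocks g : set0 \notin blocks g.
Proof. by apply/imsetP=> -[w]; rewrite inE => /eqP + /esym. Qed.

Lemma cover_blocks g v : (v \in cover (blocks g)) = (g v : bool).
Proof.
apply/bigcupP/idP => [[_ /imsetP[w _ ->]]|]; first by rewrite inE => /eqP ->.
case gv: (g v) => [w|] // _; exists (children g w); last by rewrite inE gv.
exact: children_blocks gv.
Qed.

Lemma card_blocks g : #|blocks g| = #|parents g|.
Proof. by rewrite card_in_imset // => w w' /children_inj + _; apply. Qed.

(** A vertex is a leaf exactly when it lies outside [parents g]. *)
Lemma leaf_groups_edges g : rooted g ->
  leaf_groups r (edges g) = [set G in blocks g | [disjoint G & parents g]].
Proof.
move=> rg; apply/setP=> G; rewrite [LHS]inE [RHS]inE phi_glo_edges //.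
congr (_ && _).
rewrite disjoints_subset; apply/forall_inP/subsetP => sub v /sub.
  by rewrite !inE /is_leaf child_group_edges // negbK.
by rewrite !inE /is_leaf child_group_edges // negbK.
Qed.

Lemma largest_leaf_group_edges g L : rooted g ->
  largest_avoiding (blocks g) (parents g) L ->
  largest_leaf_group r (edges g) = L.
Proof.
move=> rg Lm; rewrite /largest_leaf_group; case: pickP => [H|no].
  rewrite leaf_groups_edges // inE => /andP[/andP[HB HP] /forall_inP Hm].
  apply: largest_avoiding_uniq Lm; [exact: trivIset_blocks|exact: set0_blocks|].
  by split=> // G GB GP; apply: Hm; rewrite inE GB.
case: Lm => LB LP Lm; have := no L; rewrite leaf_groups_edges // inE LB LP /=.
by move/forall_inP=> []; move=> H; rewrite inE => /andP[HB HP]; apply: Lm.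
Qed.

Lemma largest_leaf_ex g : rooted g -> blocks g != set0 ->
  exists L, largest_avoiding (blocks g) (parents g) L.
Proof.
case=> _ _ [d dg] /set0Pn[_ /imsetP[w0 w0P _]].
(* Take a parent of maximal rank: its children rank strictly higher, so none of them is a parent. *)
case: (@arg_maxnP _ w0 (mem (parents g)) d w0P) => w wP wm.
apply: (@largest_avoiding_ex _ _ _ (children g w)).
  exact: imset_f.
rewrite disjoints_subset; apply/subsetP=> v.
rewrite [in X in X -> _]inE => /eqP gv.
rewrite inE; apply: contraTN (dg _ _ gv) => /wm; rewrite -leqNgt; exact.
Qed.

(** A parent of minimal rank must be [r], since otherwise its own parent would be one of smaller
    rank. *)
Lemma root_parent g : rooted g -> parents g != set0 -> r \in parents g.
Proof.
case=> gr up [d dg] /set0Pn[w0 w0P].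
case: (@arg_minnP _ w0 (mem (parents g)) d w0P) => w wP wm.
have [<- //|wr] := eqVneq w r.
have /parentsP[v gv] := wP.
have := up _ _ gv wr; case gw: (g w) => [u|] // _.
have /wm : u \in parents g by apply/parentsP; exists w.
by rewrite leqNgt dg.
Qed.

Lemma parent_of_group_edges g p : rooted g -> p \in parents g ->
  parent_of_group r (edges g) (children g p) = p.
Proof.
move=> rg pP; rewrite /parent_of_group; case: pickP => [q|/(_ p)].
  by rewrite child_group_edges // => /eqP /esym /(children_inj pP).
by rewrite child_group_edges // eqxx.
Qed.

(** * Pruning the largest leaf-group *)

Definition prune g L v : option 'I_n := if v \in L then None else g v.

(** The members of [L] are leaves, so the edges meeting [L] are exactly those going up from [L];
    these are the ones that [prune] forgets. *)
Lemma delete_largest_edges g L : rooted g ->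
  largest_avoiding (blocks g) (parents g) L ->
  delete_largest r (edges g) = edges (prune g L).
Proof.
move=> rg Lm; apply/setP=> e; rewrite inE (largest_leaf_group_edges rg Lm).
case: Lm => _ LP _; apply/andP/edgesP.
  case=> /edgesP[v [w [gv ->]]] /disjointFr dis; exists v, w; split=> //.
  by rewrite /prune dis // set21.
case=> v [w []]; rewrite /prune; case: ifPn => // vL gv ->; split.
  by apply/edgesP; exists v, w.
have wL : w \notin L.
  have wP : w \in parents g by apply/parentsP; exists v.
  by apply/negP=> /(disjointFr LP); rewrite wP.
by rewrite disjoints_subset; apply/subsetP=> x; rewrite !inE => /orP[]/eqP->.
Qed.

Lemma rooted_prune g L : rooted g -> [disjoint L & parents g] ->
  rooted (prune g L).
Proof.
case=> gr up [d dg] LP; split.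
- by rewrite /prune gr if_same.
- move=> v w; rewrite /prune; case: ifP => // _ gv wr.
  by rewrite (disjointFl LP) ?(up _ _ gv) //; apply/parentsP; exists v.
- by exists d => v w; rewrite /prune; case: ifP => // _; apply: dg.
Qed.

Lemma children_prune g p w : children (prune g (children g p)) w =
  if w == p then set0 else children g w.
Proof.
apply/setP=> v; rewrite inE /prune inE.
have [->|wp] := eqVneq w p; first by rewrite inE; case: ifP.
rewrite inE; case: ifP => // /eqP ->; apply/esym.
by apply: contra_neqF wp => /eqP[].
Qed.

Lemma parents_prune g p : parents (prune g (children g p)) = parents g :\ p.
Proof.
apply/setP=> w; rewrite !inE children_prune.
by case: ifP; rewrite ?eqxx.
Qed.

Lemma blocks_prune g p : p \in parents g ->
  blocks (prune g (children g p)) = blocks g :\ children g p.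
Proof.
move=> pP; apply/setP=> G; rewrite in_setD1; apply/imsetP/andP.
  case=> w; rewrite parents_prune => /setD1P[wp wP] ->.
  rewrite children_prune (negPf wp) imset_f //; split=> //.
  by apply: contra_neq wp; apply: children_inj.
case=> GL /imsetP[w wP eG]; exists w.
  rewrite parents_prune !inE; move: wP; rewrite inE => ->; rewrite andbT.
  by apply: contra_neq GL => e; rewrite eG e.
by rewrite children_prune; case: eqP => // e; rewrite eG e eqxx in GL.
Qed.

(** * The sequence [psi] as a recursion, and injectivity *)

Fixpoint psi_seq k (E : {set {set 'I_n}}) : seq 'I_n :=
  if k is k'.+1 then
    parent_of_group r E (largest_leaf_group r E)
      :: psi_seq k' (delete_largest r E)
  else [::].

Lemma val_psi k E : psi r k E = psi_seq k E :> seq _.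
Proof.
pose F Ti := parent_of_group r Ti (largest_leaf_group r Ti).
have -> : psi_seq k E = mkseq (fun i => F (iter i (delete_largest r) E)) k.
  by elim: k E => // k IH E; rewrite mkseq_iterS -IH.
by rewrite /mkseq -val_enum_ord -map_comp.
Qed.

Lemma psi_seq_step k g L : rooted g ->
  largest_avoiding (blocks g) (parents g) L ->
  exists p, [/\ p \in parents g, L = children g p &
    psi_seq k.+1 (edges g) = p :: psi_seq k (edges (prune g L))].
Proof.
move=> rg Lm; have [/imsetP[p pP eL] _ _] := Lm; exists p; split=> //=.
rewrite (largest_leaf_group_edges rg Lm) (delete_largest_edges rg Lm).
by rewrite eL parent_of_group_edges.
Qed.

(** Each step removes exactly one parent, the one it records. The root is a parent as long as any
    parent remains, so it is recorded last. *)
Lemma psi_seq_parents k g : rooted g -> #|parents g| = k ->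
  [/\ uniq (psi_seq k (edges g)), psi_seq k (edges g) =i parents g &
      last r (psi_seq k (edges g)) = r].
Proof.
elim: k g => [|k IH] g rg ck.
  by split=> // x; rewrite (cards0_eq ck) inE.
have [|L Lm] := largest_leaf_ex rg; first by rewrite -card_gt0 card_blocks ck.
have [p [pP eL ->]] := psi_seq_step k rg Lm.
have [_ LP _] := Lm; have rg' := rooted_prune rg LP.
have ep : parents (prune g L) = parents g :\ p by rewrite eL parents_prune.
have ck' : #|parents (prune g L)| = k.
  by move: ck; rewrite ep (cardsD1 p) pP => -[].
have [unq mem lst] := IH _ rg' ck'; split=> /=.
- by rewrite unq mem ep !inE eqxx.
- move=> x; rewrite inE mem ep !inE.
  by case: eqP => // ->; move: pP; rewrite inE => ->.
have : r \in parents g by apply: root_parent => //; rewrite -card_gt0 ck.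
(* If the tail is empty, no parent remains besides [p], so the parent [r] is [p]; otherwise the last
   entry comes from the tail. *)
case e: (psi_seq _ _) lst => [|y s] //= _ rP.
have := mem r; rewrite e in_nil ep !inE.
by move: rP; rewrite inE => ->; case: eqP.
Qed.

(** The entries of the common sequence are the parents on both sides. Equal blocks and equal parents
    give the same largest leaf-group, its parent is the common first entry, and induction handles
    the pruned functions. *)
Lemma psi_seq_blocks_inj k g h : rooted g -> rooted h ->
  #|parents g| = k -> blocks g = blocks h ->
  psi_seq k (edges g) = psi_seq k (edges h) -> g =1 h.
Proof.
elim: k g h => [|k IH] g h rg rh ck eB es v.
  have no f : #|parents f| = 0 -> f v = None.
    move=> /cards0_eq e; case fv: (f v) => [w|] //.
    by have /parentsP : exists u, f u = Some w by [exists v]; rewrite e inE.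
  by rewrite !no // -card_blocks -eB card_blocks.
have ckh : #|parents h| = k.+1 by rewrite -card_blocks -eB card_blocks.
have eP : parents g = parents h.
  have [_ mg _] := psi_seq_parents rg ck.
  have [_ mh _] := psi_seq_parents rh ckh.
  by apply/setP=> x; apply: etrans (esym (mg x)) _; rewrite es; apply: mh.
have [|L Lg] := largest_leaf_ex rg; first by rewrite -card_gt0 card_blocks ck.
have Lh : largest_avoiding (blocks h) (parents h) L by rewrite -eB -eP.
have [p [pg eLg eg]] := psi_seq_step k rg Lg.
have [q [qh eLh eh]] := psi_seq_step k rh Lh.
move: es; rewrite eg eh => -[epq es].
have [_ LPg _] := Lg; have [_ LPh _] := Lh.
have epr : prune g L v = prune h L v.
  apply: (IH _ _ _ _ _ _ es); rewrite ?(rooted_prune rg) ?(rooted_prune rh) //.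
  - exact: rooted_prune.
  - exact: rooted_prune.
  - by move: ck; rewrite (cardsD1 p) pg eLg parents_prune => -[].
  - by rewrite {1}eLg {1}eLh !blocks_prune // -eLg -eLh eB.
(* Outside [L] the pruned functions agree with [g] and [h]; on [L] both take the common first entry
   as value. *)
move: epr; rewrite /prune; case vL: (v \in L) => // _.
by move: (vL); rewrite {1}eLg inE => /eqP ->;
  move: vL; rewrite eLh inE => /eqP ->; rewrite epq.
Qed.

(* Each label of s other than r lies in at most one block, so by counting some
   block contains no label of s. *)
Lemma block_avoiding_ex (P : {set {set 'I_n}}) (s : seq 'I_n) :
  trivIset P -> r \notin cover P -> r \in s -> size s <= #|P| ->
  exists2 G, G \in P & [disjoint G & [set x in s]].
Proof.
move=> tP rP rs sP; apply/exists_inP; apply: contraT => /exists_inPn no.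
have sub : P \subset [set pblock P x | x in [set x in s] :\ r].
  apply/subsetP=> G GP; have := no _ GP; rewrite -setI_eq0 => /set0Pn[x].
  rewrite inE => /andP[xG xs]; apply/imsetP; exists x.
    rewrite in_setD1 xs andbT; apply: contraNneq rP => <-.
    by apply/bigcupP; exists G.
  by rewrite (def_pblock tP GP xG).
have := leq_trans (subset_leq_card sub) (leq_imset_card _ _).
rewrite leqNgt (leq_trans _ sP) //.
apply: leq_trans (card_size s); rewrite -(cardsE [in s]).
by rewrite [X in _ < X](cardsD1 r) inE rs.
Qed.

(** * Grafting, which undoes pruning, and surjectivity *)

Definition graft g p L v : option 'I_n := if v \in L then Some p else g v.

Lemma children_graft g p L w : {in L, forall v, g v = None} ->
  p \notin parents g ->
  children (graft g p L) w = if w == p then L else children g w.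
Proof.
move=> gL; rewrite inE negbK => /eqP cp; apply/setP=> v; rewrite inE /graft.
have [->|wp] := eqVneq w p.
  case: ifP => [_|]; first by rewrite eqxx.
  by move=> _; move/setP/(_ v): cp; rewrite !inE.
rewrite inE; case: ifP => // vL.
by rewrite gL //; apply: contra_neqF wp => /eqP[].
Qed.

Lemma rooted_graft g p L : rooted g -> (p == r) || g p -> r \notin L ->
  p \notin L -> [disjoint L & parents g] -> rooted (graft g p L).
Proof.
case=> gr up [d dg] gp rL pL LP; split.
- by rewrite /graft (negPf rL).
- move=> v w; rewrite /graft; case: ifP => vL.
    by case=> <- pr; move: gp; rewrite (negPf pL) (negPf pr).
  by move=> gv wr; case: ifP => // _; apply: up gv wr.
(* Ranking [L] just above [p] disturbs no other inequality, because no member of [L] is a parent in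
   [g]. *)
exists (fun v => if v \in L then (d p).+1 else d v) => v w.
rewrite /graft; case: ifP => vL.
  by case=> <-; rewrite (negPf pL).
move=> gv; rewrite (disjointFl LP) ?dg //.
by apply/parentsP; exists v.
Qed.

(** Induction on [s]: remove the largest block avoiding all entries, decode the rest, then graft
    that block onto the first entry. Labels are confined to [r |: cover P] rather than ranging over
    all of [[n]], because the ground set shrinks with each removed block. *)
Lemma psi_seq_blocks_surj (P : {set {set 'I_n}}) (s : seq 'I_n) :
  trivIset P -> set0 \notin P -> r \notin cover P ->
  uniq s -> last r s = r -> {subset s <= r |: cover P} -> size s = #|P| ->
  exists g, [/\ rooted g, blocks g = P & psi_seq #|P| (edges g) = s].
Proof.
elim: s P => [|p s IH] P tP P0 rP unq lst sub sz.
  have P00 : P = set0 by apply: cards0_eq.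
  exists (fun=> None); split; last by rewrite -sz.
    by split=> //; exists (fun=> 0).
  rewrite P00; apply/setP=> G; rewrite inE; apply/imsetP=> -[w].
  by case/parentsP.
have rs : r \in p :: s by rewrite -[X in X \in _]lst /= mem_last.
have [|G GP GA] := block_avoiding_ex tP rP rs; first by rewrite sz.
have [L Lm] := largest_avoiding_ex GP GA; have [LP LA _] := Lm.
have Ls x : x \in p :: s -> x \notin L.
  by move=> xs; apply/negP=> /(disjointFr LA); rewrite inE xs.
have rL := Ls _ rs; have pL := Ls p (mem_head _ _).
have subP : P :\ L \subset P by apply: subsetDl.
have cov x : (x \in cover (P :\ L)) = (x \in cover P) && (x \notin L).
  apply/bigcupP/andP=> [[H /setD1P[HL HP] xH]|[/bigcupP[H HP xH] xL]].
    split; first by apply/bigcupP; exists H.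
    have /trivIsetP/(_ _ _ HP LP HL) dis := tP.
    by rewrite (disjointFr dis).
  exists H => //; rewrite in_setD1 HP andbT.
  by apply: contraNneq xL => <-.
have tP' : trivIset (P :\ L) by apply: trivIsetS tP.
have P0' : set0 \notin P :\ L by rewrite in_setD1 (negPf P0) andbF.
have rP' : r \notin cover (P :\ L) by rewrite cov (negPf rP).
have cP : #|P| = #|P :\ L|.+1 by rewrite (cardsD1 L) LP.
move: (unq) => /andP[ps unqs].
(* For empty [s] this holds by the default value [r] of [last]. *)
have lst' : last r s = r by case: (s) lst.
have sub' : {subset s <= r |: cover (P :\ L)}.
  move=> x xs; have xps : x \in p :: s by rewrite inE xs orbT.
  have := sub _ xps; rewrite !inE cov => /orP[->//|->].
  by rewrite Ls // orbT.
have sz' : size s = #|P :\ L| by move: sz; rewrite cP => -[].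
have [g [rg eB es]] := IH _ tP' P0' rP' unqs lst' sub' sz'.
have ck : #|parents g| = #|P :\ L| by rewrite -eB card_blocks.
(* The parents of the decoded [g] are exactly the entries of [s]: hence [L] contains none of them,
   and [p] is not yet a parent as the sequence is duplicate-free. *)
have [_ mem _] := psi_seq_parents rg ck; rewrite es in mem.
have LPg : [disjoint L & parents g].
  rewrite disjoints_subset; apply/subsetP=> x xL; rewrite in_setC -mem.
  by apply: contraL xL => xs; apply: Ls; rewrite inE xs orbT.
have pP : p \notin parents g by rewrite -mem.
have gL : {in L, forall v, g v = None}.
  move=> v vL; have := cover_blocks g v; rewrite eB cov vL andbF.
  by case: (g v).
(* The block [L] avoids [p], so if [p] is not the root it lies in a remaining block and already has
   a parent in [g]. *)
have gp : (p == r) || g p.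
  have := sub _ (mem_head _ _); rewrite !inE => /orP[->//|pc].
  by rewrite -cover_blocks eB cov pc pL orbT.
have L0 : L != set0 by apply: contraNneq P0 => <-.
have rg' := rooted_graft rg gp rL pL LPg.
have cg := children_graft _ gL pP.
have ePg w : (w \in parents (graft g p L)) = (w == p) || (w \in parents g).
  by rewrite inE cg [in RHS]inE; case: (w =P p) => // _; rewrite L0.
have eBg : blocks (graft g p L) = P.
  rewrite -(setD1K LP) -eB; apply/setP=> H; rewrite in_setU1.
  apply/imsetP/orP=> [[w]|[/eqP->|/imsetP[w wP ->]]].
  - rewrite ePg cg => + ->; case: eqP => [->|_ /= wP]; first by left.
    by right; apply: imset_f.
  - by exists p; rewrite ?cg ?ePg eqxx.
  - exists w; first by rewrite ePg wP orbT.
    by rewrite cg ifN //; apply: contraNneq pP => <-.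
exists (graft g p L); split=> //.
(* After grafting, the parents are the entries of [p :: s], so the choice of [L] in decoding is the
   choice made by [psi]. *)
have Lm' : largest_avoiding (blocks (graft g p L)) (parents (graft g p L)) L.
  have -> : parents (graft g p L) = [set x in p :: s].
    by apply/setP=> x; rewrite ePg [RHS]in_set in_cons mem.
  by rewrite eBg.
rewrite cP; have [q [qP eL ->]] := psi_seq_step #|P :\ L| rg' Lm'.
have -> : q = p by apply: (children_inj qP); rewrite -eL cg eqxx.
rewrite -es; congr (_ :: psi_seq _ _); apply: eq_edges => v.
by rewrite /prune /graft; case: ifP => vL; [rewrite gL | rewrite vL].
Qed.

(** * Trees as edge sets of total parent functions *)

Lemma adj_sym (E : {set {set 'I_n}}) : symmetric (adj E).
Proof. by move=> x y; rewrite /adj /= setUC. Qed.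

Lemma connect_edges g x y : rooted g -> (forall v, v != r -> g v) ->
  connect (adj (edges g)) x y.
Proof.
move=> rg tot; have cr v : connect (adj (edges g)) v r.
  have [|p pth <-] := @up_path_to_root g v rg.
    by have [->|/tot] := eqVneq v r; [left | right].
  apply/connectP; exists p => //; apply: sub_path pth => a b gab.
  by rewrite adj_edges gab.
by apply: connect_trans (cr x) _; rewrite (sym_connect_sym (adj_sym _)).
Qed.

(* Both cycle neighbours of a vertex of maximal rank are its parent. *)
Lemma acyclic_edges g (c : seq 'I_n) : rooted g -> 2 < size c ->
  ~~ ucycleb (adj (edges g)) c.
Proof.
case=> _ _ [d dg] sc; apply/negP=> /andP[cyc unq].
have x0c : head r c \in c by case: (c) sc => // x s _; apply: mem_head.
case: (@arg_maxnP _ _ (mem c) d x0c) => v vc vm.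
have [i s e] := rot_to vc.
have up x : x \in c -> adj (edges g) v x -> g v = Some x.
  move=> xc; rewrite adj_edges => /orP[/eqP //|/eqP gx].
  by have := dg _ _ gx; rewrite ltnNge => /negP[]; apply: vm.
have mc x : x \in v :: s -> x \in c by rewrite -e mem_rot.
move: sc cyc unq mc; rewrite -(size_rot i) -(rot_cycle i) -(rot_uniq i) e.
case: s {e} => [|w [|z s]] //= _.
rewrite rcons_path => /and3P[vw _ /andP[_ lv]] /and3P[_ wn _] mc.
have wc : w \in c by apply: mc; rewrite !inE eqxx orbT.
have lc : last z s \in c by apply: mc; rewrite !in_cons -in_cons mem_last !orbT.
rewrite adj_sym in lv; have := up _ wc vw; rewrite (up _ lc lv) => -[elw].
by move: wn; rewrite -elw mem_last.
Qed.

Lemma is_tree_edges g : rooted g -> (forall v, v != r -> g v) ->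
  is_tree (edges g).
Proof.
move=> rg tot; apply/and3P; split.
- apply/forall_inP=> e /edgesP[v [w [gv ->]]].
  have [_ _ [d dg]] := rg; rewrite cards2.
  by have := dg _ _ gv; case: (v =P w) => // ->; rewrite ltnn.
- by apply/forallP=> x; apply/forallP=> y; apply: connect_edges.
- by apply/forallP=> c; apply/implyP; apply: acyclic_edges.
Qed.

(* The parent of v is a neighbour closer to r; an edge outside the resulting
   spanning tree would close a cycle. *)
Lemma is_tree_edgesP (E : {set {set 'I_n}}) : is_tree E ->
  exists g, [/\ rooted g, forall v, v != r -> g v & edges g = E].
Proof.
case/and3P=> /forall_inP card2 /forallP con /forallP acyc.
have ex v : exists m,
    [exists p : m.-tuple 'I_n, path (adj E) v p && (last v p == r)].
  have /forallP/(_ r)/connectP[p pth lst] := con v.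
  by exists (size p); apply/existsP; exists (in_tuple p); rewrite pth /= -lst.
pose d v := ex_minn (ex v).
pose g v := if v == r then None else [pick w | adj E v w && (d w < d v)].
have gP v w : g v = Some w -> [/\ v != r, adj E v w & d w < d v].
  rewrite /g; case: eqP => // _.
  by case: pickP => // u /andP[vu du] [<-].
have tot v : v != r -> g v.
  move=> vr; rewrite /g (negPf vr); case: pickP => // no.
  have /existsP[p /andP[]] : [exists p : (d v).-tuple 'I_n,
    path (adj E) v p && (last v p == r)] by rewrite /d; case: ex_minnP.
  case: p => -[|w p] /= sp; first by rewrite (negPf vr).
  case/andP=> vw pth lst; have := no w; rewrite vw /= => /negP[].
  rewrite /d; case: (ex_minnP (ex w)) => m _ mmin.
  rewrite -/(d v) -(eqP sp) ltnS; apply: mmin; apply/existsP.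
  by exists (in_tuple p); rewrite pth.
have rg : rooted g.
  split; first by rewrite /g eqxx.
    by move=> v w _ /tot.
  by exists d => v w /gP[].
exists g; split=> //; have sub : {subset edges g <= E}.
  by move=> e /edgesP[v [w [/gP[_ vw _] ->]]].
apply/setP=> e; apply/idP/idP => [/sub //|eE].
have /cards2P[x [y [xy ee]]] := card2 _ eE.
have /connectP[p0 pth0 ey] := connect_edges x y rg tot.
move: ey xy; case/shortenP: pth0 => p pth unq _ ey xy.
case: p pth unq ey => [|z [|t p]] pth unq ey.
- by rewrite ey eqxx in xy.
- by move: pth; rewrite ee ey /= andbT.
have /implyP/(_ isT)/negP[] := acyc (Bseq (size_uniq_ord unq)).
suff: path (adj E) x (rcons [:: z, t & p] x) by rewrite /ucycleb unq andbT.
rewrite rcons_path; apply/andP; split.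
  by apply: sub_path pth => a b; apply: sub.
by rewrite adj_sym -ey /adj /= -ee.
Qed.

Lemma partition_blocks g : g r = None -> (forall v, v != r -> g v) ->
  partition (blocks g) [set~ r].
Proof.
move=> gr tot; rewrite /partition trivIset_blocks set0_blocks !andbT.
apply/eqP/setP=> v; rewrite cover_blocks !inE.
by case: eqP => [->|/eqP/tot ->//]; rewrite gr.
Qed.

End ParentFunctions.

(** * Transfer to trees, types and the bijection *)

Lemma treesP n (r : 'I_n) k (E : {set {set 'I_n}}) :
  reflect (exists g, [/\ rooted r g, forall v, v != r -> g v,
                         #|parents g| = k & edges g = E])
          (E \in trees r k).
Proof.
rewrite inE; apply: (iffP andP).
  case=> /(is_tree_edgesP r)[g [rg tot <-]].
  rewrite phi_glo_edges // card_blocks.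
  by move/eqP; exists g.
case=> g [rg tot <- <-]; split; first exact: is_tree_edges tot.
by rewrite phi_glo_edges // card_blocks.
Qed.

(** Parts are counted from size 1 on, so only vertices with children matter; on these [children g]
    is injective, and it matches those with [i] children with the blocks of size [i]. *)
Lemma indegree_type_edges n (r : 'I_n) g : rooted r g ->
  global_indegree_sequence r (edges g) = partition_type (blocks g).
Proof.
move=> rg; congr flatten; apply/eq_in_map => i; rewrite mem_iota => /andP[i0 _].
congr nseq; rewrite -(@card_in_imset _ _ (children g)); last first.
  move=> v w; rewrite inE child_group_edges // => /eqP cv _.
  by apply: children_inj; rewrite inE -card_gt0 cv.
apply: eq_card => B; rewrite [RHS]inE; apply/imsetP/andP => [[v]|].
  rewrite inE child_group_edges // => cv ->; split=> //; apply: imset_f.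
  by rewrite inE -card_gt0 (eqP cv).
case=> /imsetP[v _ ->] cv; exists v => //.
by rewrite inE child_group_edges.
Qed.

Theorem theorem2p1 (n : nat) (r : 'I_n) (k : nat)
    (hn : 2 <= n) (hk : 1 <= k <= n - 1) :
  let f := fun T : {set {set 'I_n}} => (phi_glo r T, psi r k T) in
  [/\ {in trees r k &, injective f},
      f @: trees r k = setX (partitions r k) (sequences r k) &
      forall T, T \in trees r k ->
        global_indegree_sequence r T = partition_type (phi_glo r T)].
Proof.
move=> f; split.
- move=> _ _ /treesP[g [rg _ cg <-]] /treesP[h [rh _ ch <-]].
  case/pair_equal_spec=> eB /(congr1 val) es.
  rewrite (phi_glo_edges rg) (phi_glo_edges rh) in eB.
  have {}es := etrans (esym (val_psi r k _)) (etrans es (val_psi r k _)).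
  exact/eq_edges/(psi_seq_blocks_inj rg rh cg eB es).
- apply/setP=> -[P s]; rewrite in_setX; apply/imsetP/andP.
    case=> _ /treesP[g [rg tot cg <-]] /pair_equal_spec[-> ->].
    have [unq _ lst] := psi_seq_parents rg cg.
    have [gr _ _] := rg.
    rewrite !inE val_psi unq lst eqxx phi_glo_edges // card_blocks cg eqxx.
    by rewrite partition_blocks.
  rewrite !inE => -[/andP[/and3P[/eqP cP tP P0] /eqP kP] /andP[unq /eqP lst]].
  (* Since [P] covers everything but [r], the set [r |: cover P] is all of [[n]], so the confinement
     of labels is automatic. *)
  have [|||g [rg eB es]] := psi_seq_blocks_surj tP P0 _ unq lst.
  + by rewrite cP !inE eqxx.
  + by move=> x _; rewrite cP !inE; case: eqP.
  + by rewrite size_tuple kP.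
  exists (edges g).
    apply/treesP; exists g; split=> //; last by rewrite -card_blocks eB.
    by move=> v vr; rewrite -cover_blocks eB cP !inE.
  congr pair; first by rewrite phi_glo_edges.
  by apply: val_inj; rewrite /= val_psi; rewrite kP in es; rewrite es.
by move=> _ /treesP[g [rg _ _ <-]];
  rewrite phi_glo_edges // indegree_type_edges.
Qed.
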